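(* Let $\alpha\ge0$ and $j,\ell\in\mathbb{N}$. There exists a constant $c>0$ such that, uniformly in $k\in\mathbb{N}$ and $u\in(0,c(k+1)^{-1})$: if $\ell\ge j$, then $$\frac{d^j}{du^j}\frac{\mathcal{L}_k^\alpha(u)}{u^{\alpha/2-\ell}}\simeq(k+1)^{\alpha/2}u^{\ell-j},$$ and if $\ell\le j$, then $$\frac{d^j}{du^j}\frac{\mathcal{L}_k^\alpha(u)}{u^{\alpha/2-\ell}}\simeq(-1)^{j-\ell}(k+1)^{\alpha/2+j-\ell}.$$
   Context: $\mathbb{N}=\{0,1,2,\ldots\}$. The standard Laguerre functions are $\mathcal{L}_k^\alpha(u)=\big(\frac{\Gamma(k+1)}{\Gamma(k+\alpha+1)}\big)^{1/2}L_k^\alpha(u)e^{-u/2}u^{\alpha/2}$, $u>0$, where $L_k^\alpha$ is the Laguerre polynomial of degree $k$ and order $\alpha$. For positive $B$, $A\simeq B$ uniformly means that there are constants $0<m\le M$, independent of $k$ and $u$ (they may depend on $\alpha,j,\ell$), with $mB\le A\le MB$; $A\simeq-B$ means that $A$ is negative and $-A\simeq B$. (Thus $A\simeq(-1)^iB$ also asserts that $A$ has sign $(-1)^i$.) *)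

(* Defs.v *)
From Stdlib Require Import Reals Factorial.
From Coquelicot Require Import Coquelicot.
Open Scope R_scope.

(* Euler's integral over (0, infinity); the value is meaningful for 0 < x. *)
Definition Gamma (x : R) : R :=
  RInt_gen (fun t => Rpower t (x - 1) * exp (- t))
    (at_right 0) (Rbar_locally p_infty).

(* a (a - 1) ... (a - n + 1) / n! *)
Fixpoint gbinom (a : R) (n : nat) : R :=
  match n with
  | O => 1
  | S n' => gbinom a n' * (a - INR n') / INR (S n')
  end.

(* L_k^alpha(u) = sum_{i=0}^{k} binom(k + alpha, k - i) (-u)^i / i! *)
Definition laguerre_poly (k : nat) (alpha u : R) : R :=
  sum_f_R0
    (fun i => gbinom (INR k + alpha) (k - i) * (- u) ^ i / INR (fact i)) k.

Definition laguerre_fun (k : nat) (alpha u : R) : R :=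
  sqrt (Gamma (INR k + 1) / Gamma (INR k + alpha + 1))
  * laguerre_poly k alpha u * exp (- u / 2) * Rpower u (alpha / 2).

(* A ~= B uniformly on D, for B positive on D: the constants m and M are
   chosen before the point (k, u). *)
Definition simeq (D : nat -> R -> Prop) (A B : nat -> R -> R) : Prop :=
  exists m M : R, 0 < m <= M /\
    forall (k : nat) (u : R), D k u -> m * B k u <= A k u <= M * B k u.

(* A ~= - B uniformly on D. *)
Definition simeq_opp (D : nat -> R -> Prop) (A B : nat -> R -> R) : Prop :=
  (forall (k : nat) (u : R), D k u -> A k u < 0) /\
  simeq D (fun k u => - A k u) B.

(* A ~= (-1)^i B uniformly on D. *)
Definition simeq_sign (D : nat -> R -> Prop) (i : nat)
    (A B : nat -> R -> R) : Prop :=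
  if Nat.even i then simeq D A B else simeq_opp D A B.

(* Main.v *)
(* Up to the normalisation N_k, the differentiated function is u^l h_k(u) with
   h_k(u) = L_k^alpha(u) e^(-u/2). All Taylor coefficients of h_k(-u) are positive, and the n-th
   one is at most h_k(0) (k+1)^n / n! and, for fixed n, at least a constant times h_k(0) (k+1)^n.
   Differentiating the power series of u^l h_k termwise, everything after the lowest surviving
   term is dominated by a geometric series in 2 (k+1) u, which is small against that term once
   (k+1) u < c. It remains to see that N_k h_k(0) ~ (k+1)^(alpha/2): by the functional equation
   of Gamma, N_k h_k(0) is a constant times the square root of the product of the
   1 + alpha / i over 1 <= i <= k. *)
Require Import Defs.
From Stdlib Require Import Reals Factorial Lra Lia.
From Coquelicot Require Import Coquelicot.
Open Scope R_scope.

(** * Euler's integral for Gamma and its functional equation *)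

Lemma ln_le_sub1 (y : R) : 0 < y -> ln y <= y - 1.
Proof.
  intros hy. pose proof (exp_ineq1_le (ln y)) as h. rewrite exp_ln in h; lra.
Qed.

(** The tangent bound for the logarithm, taken at scale [2 * (s + 1)], lets the power consume at
    most half of the exponential decay. The resulting majorant serves both for convergence and for
    the limit at infinity. *)
Lemma gamma_integrand_bound (s t : R) :
  0 <= s -> 0 < t ->
  Rpower t s * exp (- t) <= exp (s * ln (2 * (s + 1))) * exp (- t / 2).
Proof.
  intros hs ht. unfold Rpower. rewrite <- !exp_plus.
  assert (hl : ln t <= t / (2 * (s + 1)) + ln (2 * (s + 1))).
  { assert (h0 : 0 < t / (2 * (s + 1))) by (apply Rdiv_lt_0_compat; lra).
    replace t with (t / (2 * (s + 1)) * (2 * (s + 1))) at 1 by (field; lra).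
    rewrite ln_mult by lra. pose proof (ln_le_sub1 _ h0). lra. }
  assert (h1 : s * ln t <= t / 2 + s * ln (2 * (s + 1))).
  { apply Rle_trans with (s * (t / (2 * (s + 1)) + ln (2 * (s + 1)))).
    - apply Rmult_le_compat_l; lra.
    - assert (s * (t / (2 * (s + 1))) <= t / 2); [|lra].
      replace (t / 2) with ((s + 1) * (t / (2 * (s + 1)))) by (field; lra).
      apply Rmult_le_compat_r; [|lra].
      apply Rlt_le, Rdiv_lt_0_compat; lra. }
  destruct (Req_dec (s * ln t + - t) (s * ln (2 * (s + 1)) + - t / 2)) as [->|].
  - lra.
  - apply Rlt_le, exp_increasing. lra.
Qed.

Lemma gamma_integrand_continuous (s t : R) :
  0 < t -> continuous (fun t => Rpower t s * exp (- t)) t.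
Proof.
  intros ht. apply (ex_derive_continuous (V := R_NormedModule)).
  unfold Rpower. auto_derive. lra.
Qed.

Lemma at_right_0_p_infty (a b : R) :
  0 < a ->
  filter_prod (at_right 0) (Rbar_locally p_infty)
    (fun ab => 0 < fst ab < a /\ b < snd ab).
Proof.
  intros ha.
  apply Filter_prod with (fun x => 0 < x < a) (fun y => b < y).
  - exists (mkposreal a ha). intros y hy hpos.
    change (Rabs (y - 0) < a) in hy.
    rewrite Rminus_0_r, Rabs_pos_eq in hy; lra.
  - exists b. easy.
  - simpl. auto.
Qed.

(** For a nonnegative integrand the integral grows with the interval, so the improper integral is
    the supremum over compact subintervals. The second conjunct later gives strict positivity. *)
Lemma is_RInt_gen_0_infty_sup (f : R -> R) (M : R) :
  (forall t, 0 < t -> 0 <= f t) ->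
  (forall t, 0 < t -> continuous f t) ->
  (forall a b, 0 < a < b -> RInt f a b <= M) ->
  exists I : R, is_RInt_gen f (at_right 0) (Rbar_locally p_infty) I /\
    forall a b, 0 < a < b -> RInt f a b <= I.
Proof.
  intros hpos hcont hM.
  assert (hex : forall a b, 0 < a -> 0 < b -> ex_RInt f a b).
  { intros a b ha hb. apply (ex_RInt_continuous (V := R_CompleteNormedModule)). intros z hz. apply hcont.
    unfold Rmin in hz. destruct (Rle_dec a b); lra. }
  set (E := fun v : R => exists a b, 0 < a < b /\ v = RInt f a b).
  destruct (completeness E) as [I [hub hlub]].
  - exists M. intros v (a & b & hab & ->). now apply hM.
  - exists (RInt f 1 2), 1, 2. split; [lra | easy].
  - exists I. split.
    2:{ intros a b hab. apply hub. now exists a, b. }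
    assert (hmono : forall a0 b0 a b, 0 < a <= a0 -> a0 < b0 <= b ->
              RInt f a0 b0 <= RInt f a b).
    { intros a0 b0 a b h1 h2.
      rewrite <- (RInt_Chasles f a a0 b) by (apply hex; lra).
      rewrite <- (RInt_Chasles f a0 b0 b) by (apply hex; lra).
      unfold plus; simpl.
      assert (0 <= RInt f a a0)
        by (apply RInt_ge_0; [lra | apply hex; lra | intros; apply hpos; lra]).
      assert (0 <= RInt f b0 b)
        by (apply RInt_ge_0; [lra | apply hex; lra | intros; apply hpos; lra]).
      lra. }
    intros P [eps heps].
    (* If no interval came within [eps] of the supremum, [I - eps] would be a smaller upper
       bound. *)
    assert (hnear : exists a0 b0, 0 < a0 < b0 /\ I - eps < RInt f a0 b0).
    { destruct (Classical_Prop.classic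
        (exists a0 b0, 0 < a0 < b0 /\ I - eps < RInt f a0 b0)) as [h|h]; [easy|].
      exfalso. assert (hI : I <= I - eps).
      { apply hlub. intros v (a & b & hab & ->).
        apply Rnot_lt_le. intros hlt. apply h. now exists a, b. }
      pose proof (cond_pos eps). lra. }
    destruct hnear as (a0 & b0 & hab0 & hI).
    unfold filtermapi.
    eapply filter_imp; [|exact (at_right_0_p_infty a0 b0 ltac:(lra))].
    intros [a b]; simpl. intros [ha hb].
    exists (RInt f a b). split.
    + apply (RInt_correct (V := R_CompleteNormedModule)), hex; lra.
    + apply heps. change (Rabs (RInt f a b - I) < eps).
      assert (RInt f a b <= I) by (apply hub; exists a, b; split; [lra | easy]).
      pose proof (hmono a0 b0 a b ltac:(lra) ltac:(lra)).
      apply Rabs_def1; lra.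
Qed.

Lemma gamma_integral (s : R) :
  0 <= s ->
  exists I : R, 0 < I /\
    is_RInt_gen (fun t => Rpower t s * exp (- t))
      (at_right 0) (Rbar_locally p_infty) I.
Proof.
  intros hs.
  set (f := fun t => Rpower t s * exp (- t)).
  assert (hfpos : forall t, 0 < f t).
  { intros t. apply Rmult_lt_0_compat; apply exp_pos. }
  set (C := exp (s * ln (2 * (s + 1)))).
  (* [C * 2] is the integral of the majorant [C * exp (- t / 2)] over (0, infinity). *)
  destruct (is_RInt_gen_0_infty_sup f (C * 2)) as (I & hI & hle).
  - intros t _. apply Rlt_le, hfpos.
  - intros t ht. now apply gamma_integrand_continuous.
  - intros a b hab.
    assert (hg : is_RInt (fun t => C * exp (- t / 2)) a b
                   (- 2 * C * exp (- b / 2) - - 2 * C * exp (- a / 2))).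
    { apply (is_RInt_derive (V := R_CompleteNormedModule)
               (fun t => - 2 * C * exp (- t / 2))).
      - intros x _. auto_derive; [easy|]. unfold Rdiv. field.
      - intros x _. apply (ex_derive_continuous (V := R_NormedModule)).
        auto_derive. easy. }
    apply Rle_trans with (RInt (fun t => C * exp (- t / 2)) a b).
    + apply RInt_le; [lra | | now exists (- 2 * C * exp (- b / 2) - - 2 * C * exp (- a / 2)) | ].
      * apply (ex_RInt_continuous (V := R_CompleteNormedModule)). intros z hz. apply gamma_integrand_continuous.
        rewrite Rmin_left in hz; lra.
      * intros x hx. apply gamma_integrand_bound; lra.
    + rewrite (is_RInt_unique _ _ _ _ hg).
      assert (0 < C) by apply exp_pos.
      assert (0 < exp (- b / 2)) by apply exp_pos.
      assert (exp (- a / 2) <= 1).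
      { rewrite <- exp_0. apply Rlt_le, exp_increasing. lra. }
      nra.
  - exists I. split; [|easy].
    (* Strict positivity is inherited from the piece over [1, 2]. *)
    apply Rlt_le_trans with (RInt f 1 2); [|apply hle; lra].
    apply RInt_gt_0; [lra | intros; apply hfpos |].
    intros x hx. apply gamma_integrand_continuous. lra.
Qed.

Lemma Gamma_correct (x : R) :
  1 <= x ->
  0 < Gamma x /\
  is_RInt_gen (fun t => Rpower t (x - 1) * exp (- t))
    (at_right 0) (Rbar_locally p_infty) (Gamma x).
Proof.
  intros hx. destruct (gamma_integral (x - 1)) as (I & hI & h); [lra|].
  unfold Gamma. now rewrite (is_RInt_gen_unique _ _ h).
Qed.

(** For [t < 1] and [s >= 1] the power is at most [t]. This and the next limit are the boundary
    terms of an integration by parts. *)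
Lemma Rpower_exp_lim_0 (s : R) :
  1 <= s ->
  filterlim (fun t => - (Rpower t s * exp (- t))) (at_right 0) (locally 0).
Proof.
  intros hs. apply filterlim_locally. intros eps.
  assert (hd : 0 < Rmin 1 eps) by (apply Rmin_pos; [lra | apply cond_pos]).
  exists (mkposreal _ hd). intros t ht htpos.
  change (Rabs (t - 0) < Rmin 1 eps) in ht.
  rewrite Rminus_0_r, Rabs_pos_eq in ht by lra.
  pose proof (Rmin_l 1 eps). pose proof (Rmin_r 1 eps).
  change (Rabs (- (Rpower t s * exp (- t)) - 0) < eps).
  rewrite Rminus_0_r, Rabs_Ropp, Rabs_pos_eq
    by (apply Rmult_le_pos; apply Rlt_le, exp_pos).
  assert (h1 : Rpower t s <= t).
  { rewrite <- (exp_ln t htpos) at 2. unfold Rpower.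
    assert (hln : ln t <= 0) by (pose proof (ln_le_sub1 t htpos); lra).
    destruct (Rle_lt_or_eq_dec (s * ln t) (ln t)) as [h|h]; [nra | |].
    - apply Rlt_le, exp_increasing, h.
    - rewrite h. lra. }
  assert (h2 : exp (- t) <= 1).
  { rewrite <- exp_0. apply Rlt_le, exp_increasing. lra. }
  assert (h3 : 0 < Rpower t s) by apply exp_pos.
  assert (h4 : 0 < exp (- t)) by apply exp_pos.
  nra.
Qed.

Lemma Rpower_exp_lim_p_infty (s : R) :
  0 <= s ->
  filterlim (fun t => - (Rpower t s * exp (- t)))
    (Rbar_locally p_infty) (locally 0).
Proof.
  intros hs. apply filterlim_locally. intros eps.
  set (C := exp (s * ln (2 * (s + 1)))).
  assert (hC : 0 < C) by apply exp_pos.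
  assert (heps := cond_pos eps).
  (* Beyond this threshold [C < eps * (t / 2) < eps * exp (t / 2)], which makes the majorant smaller
     than [eps]. *)
  exists (Rmax 0 (2 * C / eps)). intros t ht.
  pose proof (Rmax_l 0 (2 * C / eps)). pose proof (Rmax_r 0 (2 * C / eps)).
  change (Rabs (- (Rpower t s * exp (- t)) - 0) < eps).
  rewrite Rminus_0_r, Rabs_Ropp, Rabs_pos_eq
    by (apply Rmult_le_pos; apply Rlt_le, exp_pos).
  apply Rle_lt_trans with (1 := gamma_integrand_bound s t hs ltac:(lra)).
  fold C. replace (- t / 2) with (- (t / 2)) by field. rewrite exp_Ropp.
  assert (h1 : t / 2 < exp (t / 2)) by (pose proof (exp_ineq1_le (t / 2)); lra).
  apply Rmult_lt_reg_r with (exp (t / 2)); [apply exp_pos|].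
  rewrite Rmult_assoc, Rinv_l, Rmult_1_r
    by (apply Rgt_not_eq, exp_pos).
  apply Rlt_trans with (eps * (t / 2)); [|now apply Rmult_lt_compat_l].
  assert (h2 : 2 * C / eps < t) by lra.
  apply (Rmult_lt_compat_l (eps / 2)) in h2; [|lra].
  replace (eps / 2 * (2 * C / eps)) with C in h2 by (field; lra). lra.
Qed.

(** Integration by parts: the derivative of [- t^x e^(-t)] is the integrand of [Gamma (x + 1)] minus
    [x] times that of [Gamma x], and both boundary values vanish. *)
Lemma Gamma_succ (x : R) : 1 <= x -> Gamma (x + 1) = x * Gamma x.
Proof.
  intros hx.
  destruct (Gamma_correct x hx) as [_ h0].
  destruct (Gamma_correct (x + 1) ltac:(lra)) as [_ h1].
  set (f := fun t => - (Rpower t x * exp (- t))).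
  set (f' := fun t => Rpower t (x + 1 - 1) * exp (- t)
                      + - x * (Rpower t (x - 1) * exp (- t))).
  assert (hder : forall t, 0 < t -> is_derive f t (f' t)).
  { intros t ht. unfold f, f', Rpower. auto_derive; [easy|].
    replace ((x + 1 - 1) * ln t) with ((x - 1) * ln t + ln t) by ring.
    replace (x * ln t) with ((x - 1) * ln t + ln t) by ring.
    rewrite !exp_plus, exp_ln by easy. field. lra. }
  assert (hpos : filter_prod (at_right 0) (Rbar_locally p_infty)
            (fun ab : R * R => 0 < Rmin (fst ab) (snd ab))).
  { eapply filter_imp; [|exact (at_right_0_p_infty 1 1 ltac:(lra))].
    intros [a b]; simpl. intros h. apply Rmin_pos; lra. }
  (* The formula [f'] is known to be the derivative only on the positive half-line, so continuity is
     transferred locally. *)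
  assert (hcont : forall t, 0 < t -> continuous (Derive f) t).
  { intros t ht. apply continuous_ext_loc with f'.
    - apply (locally_interval _ t 0 p_infty); simpl; try easy.
      intros y hy _. symmetry. now apply is_derive_unique, hder.
    - apply (ex_derive_continuous (V := R_NormedModule)).
      unfold f', Rpower. auto_derive. easy. }
  assert (hI : is_RInt_gen (Derive f) (at_right 0) (Rbar_locally p_infty) (0 - 0)).
  { apply is_RInt_gen_Derive.
    - eapply filter_imp; [|exact hpos]. intros ab hab t ht.
      exists (f' t). apply hder. lra.
    - eapply filter_imp; [|exact hpos]. intros ab hab t ht. apply hcont. lra.
    - now apply Rpower_exp_lim_0.
    - apply Rpower_exp_lim_p_infty. lra. }
  assert (hJ := is_RInt_gen_plus _ _ _ _ h1 (is_RInt_gen_scal _ (- x) _ h0)).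
  assert (hJ' : is_RInt_gen (Derive f) (at_right 0) (Rbar_locally p_infty)
            (plus (Gamma (x + 1)) (scal (- x) (Gamma x)))).
  { eapply is_RInt_gen_ext; [|exact hJ].
    eapply filter_imp; [|exact hpos]. intros ab hab t ht.
    symmetry. apply is_derive_unique, hder. lra. }
  apply (is_RInt_gen_unique (V := R_CompleteNormedModule)) in hI.
  apply (is_RInt_gen_unique (V := R_CompleteNormedModule)) in hJ'.
  rewrite hI in hJ'. change (0 - 0 = Gamma (x + 1) + - x * Gamma x) in hJ'.
  lra.
Qed.

(** * Power series, and the expansion of the Laguerre polynomial times the exponential *)

(** At [r + 1], outside a finite radius [r], the terms would not tend to 0, against convergence
    there. *)
Lemma CV_radius_entire (a : nat -> R) :
  (forall x, ex_pseries a x) -> CV_radius a = p_infty.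
Proof.
  intros h.
  assert (h0 := CV_radius_ge_0 a).
  destruct (CV_radius a) as [r| |] eqn:hr; [|easy|easy].
  exfalso. simpl in h0.
  apply (CV_disk_outside a (r + 1)).
  - rewrite hr, Rabs_pos_eq by lra. simpl. lra.
  - apply ex_series_lim_0. destruct (h (r + 1)) as [s hs].
    exists s. now apply is_pseries_R.
Qed.

Lemma is_series_finite (a : nat -> R) (k : nat) :
  (forall i, (k < i)%nat -> a i = 0) -> is_series a (sum_f_R0 a k).
Proof.
  intros h.
  change (is_lim_seq (sum_n a) (sum_f_R0 a k)).
  apply is_lim_seq_ext_loc with (fun _ => sum_f_R0 a k);
    [|apply is_lim_seq_const].
  exists k. intros n hn. rewrite sum_n_Reals.
  induction hn as [|n hn IH]; [easy|].
  simpl. rewrite <- IH, h by lia. ring.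
Qed.

(** After the constant term the series is [x] times one dominated by a geometric series of ratio
    [rho * x <= 1 / 2], whose sum is at most twice its first term [K * rho]. This separates the
    leading term from the rest. *)
Lemma PSeries_minus_head (e : nat -> R) (K rho x : R) :
  CV_radius e = p_infty -> 0 <= K -> 0 <= rho ->
  (forall r, Rabs (e r) <= K * rho ^ r) ->
  0 <= x -> rho * x <= 1 / 2 ->
  Rabs (PSeries e x - e O) <= 2 * K * rho * x.
Proof.
  intros hcv hK hrho he hx hrx.
  assert (h1 : ex_pseries e x) by (apply CV_radius_inside; now rewrite hcv).
  rewrite (PSeries_decr_1 e x h1).
  replace (e O + x * PSeries (PS_decr_1 e) x - e O)
    with (x * PSeries (PS_decr_1 e) x) by ring.
  rewrite Rabs_mult, (Rabs_pos_eq x hx).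
  assert (habs : ex_series (fun n => Rabs (PS_decr_1 e n * x ^ n))).
  { apply CV_disk_inside. rewrite CV_radius_decr_1. now rewrite hcv. }
  assert (hq : Rabs (rho * x) < 1) by (rewrite Rabs_pos_eq; nra).
  assert (hg : is_series (fun n => K * rho * (rho * x) ^ n)
                 (K * rho * / (1 - rho * x)))
    by exact (is_series_scal_l (K * rho) _ _ (is_series_geom _ hq)).
  assert (hle : Rabs (PSeries (PS_decr_1 e) x) <= 2 * K * rho).
  { apply Rle_trans with (1 := Series_Rabs _ habs).
    apply Rle_trans with (Series (fun n => K * rho * (rho * x) ^ n)).
    - apply Series_le.
      + intros n. split; [apply Rabs_pos|].
        rewrite Rabs_mult, (Rabs_pos_eq (x ^ n)) by (now apply pow_le).
        rewrite Rpow_mult_distr, <- Rmult_assoc.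
        apply Rmult_le_compat_r; [now apply pow_le|].
        rewrite Rmult_assoc. exact (he (S n)).
      + eexists. exact hg.
    - rewrite (is_series_unique _ _ hg).
      apply Rle_trans with (K * rho * 2); [|lra].
      apply Rmult_le_compat_l; [now apply Rmult_le_pos|].
      rewrite <- (Rinv_inv 2). apply Rinv_le_contravar; lra. }
  nra.
Qed.

(* The coefficient of (- u) ^ i in [laguerre_poly]. The cut-off matters: with truncated
   subtraction, [gbinom _ (k - i)] is 1 beyond the degree. *)
Definition laguerre_coef (k : nat) (alpha : R) (i : nat) : R :=
  if Nat.leb i k then gbinom (INR k + alpha) (k - i) / INR (fact i) else 0.

Definition half_exp_coef (i : nat) : R := (1 / 2) ^ i / INR (fact i).

(** The Taylor coefficients of h_k(-u), as a Cauchy product. Expanding in [- u] makes both factors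
    nonnegative for [alpha >= 0], so no cancellation can spoil lower bounds. *)
Definition laguerre_exp_coef (k : nat) (alpha : R) : nat -> R :=
  PS_mult (laguerre_coef k alpha) half_exp_coef.

Lemma is_pseries_laguerre_coef (k : nat) (alpha u : R) :
  is_pseries (laguerre_coef k alpha) (- u) (laguerre_poly k alpha u).
Proof.
  apply is_pseries_R. unfold laguerre_poly.
  rewrite (sum_eq _ (fun i => laguerre_coef k alpha i * (- u) ^ i)).
  - apply is_series_finite. intros i hi. unfold laguerre_coef.
    destruct (Nat.leb_spec i k); [lia | ring].
  - intros i hi. unfold laguerre_coef.
    destruct (Nat.leb_spec i k); [|lia]. field. apply INR_fact_neq_0.
Qed.

Lemma is_pseries_half_exp_coef (u : R) :
  is_pseries half_exp_coef (- u) (exp (- u / 2)).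
Proof.
  apply is_pseries_R. assert (h := is_exp_Reals (- u / 2)).
  apply is_pseries_R in h. eapply is_series_ext; [|exact h].
  intros n. unfold half_exp_coef.
  replace (- u / 2) with (1 / 2 * - u) by field.
  rewrite Rpow_mult_distr. 
  match goal with |- ?a = ?b => change (@eq R a b) end.
  unfold Rdiv. ring.
Qed.

Lemma is_pseries_laguerre_exp_coef (k : nat) (alpha u : R) :
  is_pseries (fun n => (- 1) ^ n * laguerre_exp_coef k alpha n) u
    (laguerre_poly k alpha u * exp (- u / 2)).
Proof.
  assert (h : is_pseries (laguerre_exp_coef k alpha) (- u)
                (laguerre_poly k alpha u * exp (- u / 2))).
  { apply is_pseries_mult.
    - apply is_pseries_laguerre_coef.
    - apply is_pseries_half_exp_coef.
    - rewrite CV_radius_entire; [easy|]. intros x.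
      rewrite <- (Ropp_involutive x). eexists. apply is_pseries_laguerre_coef.
    - rewrite CV_radius_entire; [easy|]. intros x.
      rewrite <- (Ropp_involutive x). eexists. apply is_pseries_half_exp_coef. }
  apply is_pseries_R. apply is_pseries_R in h.
  eapply is_series_ext; [|exact h]. intros n; cbv beta.
  replace (- u) with (- 1 * u) by ring. rewrite Rpow_mult_distr.
  match goal with |- ?a = ?b => change (@eq R a b) end. ring.
Qed.

(** * Two-sided bounds for the Taylor coefficients *)

Lemma gbinom_pos (a : R) (n : nat) : INR n < a + 1 -> 0 < gbinom a n.
Proof.
  induction n as [|n IH]; intros h; [simpl; lra|].
  rewrite S_INR in h. cbn [gbinom]. assert (0 <= INR n) by apply pos_INR.
  apply Rdiv_lt_0_compat; [|rewrite S_INR; lra].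
  apply Rmult_lt_0_compat; [apply IH; lra | lra].
Qed.

(** The recursion of [gbinom] read downwards from the diagonal; the explicit ratio drives the two
    inductions that follow. *)
Lemma gbinom_below_diag (k i : nat) (alpha : R) :
  0 <= alpha -> (S i <= k)%nat ->
  gbinom (INR k + alpha) (k - S i)
  = gbinom (INR k + alpha) (k - i) * ((INR k - INR i) / (alpha + INR i + 1)).
Proof.
  intros ha hi. assert (0 <= INR i) by apply pos_INR.
  replace (k - i)%nat with (S (k - S i)) by lia. cbn [gbinom].
  replace (S (k - S i)) with (k - i)%nat by lia.
  assert (INR (S i) <= INR k) by (now apply le_INR).
  rewrite !minus_INR by lia. rewrite S_INR in *. field. lra.
Qed.

(** Each of the [i] ratios is at most [k]. *)
Lemma gbinom_below_diag_le (k i : nat) (alpha : R) :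
  0 <= alpha -> (i <= k)%nat ->
  gbinom (INR k + alpha) (k - i) <= gbinom (INR k + alpha) k * INR k ^ i.
Proof.
  intros ha. induction i as [|i IH]; intros hi.
  - rewrite Nat.sub_0_r. simpl. lra.
  - rewrite gbinom_below_diag by easy.
    assert (0 <= INR i) by apply pos_INR.
    assert (0 < gbinom (INR k + alpha) (k - i))
      by (apply gbinom_pos; rewrite minus_INR by lia; lra).
    assert (INR (S i) <= INR k) by (now apply le_INR). rewrite S_INR in *.
    apply Rle_trans with (gbinom (INR k + alpha) (k - i) * INR k).
    + apply Rmult_le_compat_l; [lra|].
      apply Rmult_le_reg_r with (alpha + INR i + 1); [lra|].
      unfold Rdiv. rewrite Rmult_assoc, Rinv_l by lra. nra.
    + simpl. rewrite (Rmult_comm (INR k)), <- Rmult_assoc.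
      apply Rmult_le_compat_r; [lra|]. apply IH. lia.
Qed.

(** With [n] fixed during the induction on [i], every ratio met is at least the same multiple of
    [k + 1], the multiple depending only on [n] and [alpha]. *)
Lemma gbinom_below_diag_ge (k n i : nat) (alpha : R) :
  0 <= alpha -> (i <= n)%nat -> (n <= k)%nat ->
  gbinom (INR k + alpha) k
  * ((INR k + 1) / ((INR n + 1) * (alpha + INR n + 1))) ^ i
  <= gbinom (INR k + alpha) (k - i).
Proof.
  intros ha. induction i as [|i IH]; intros hi hn.
  - rewrite Nat.sub_0_r. simpl. lra.
  - rewrite gbinom_below_diag by (easy || lia).
    assert (0 <= INR i) by apply pos_INR.
    assert (0 < gbinom (INR k + alpha) (k - i))
      by (apply gbinom_pos; rewrite minus_INR by lia; lra).
    assert (hi' := le_INR _ _ hi). assert (hn' := le_INR _ _ hn).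
    rewrite S_INR in hi'.
    set (t := (INR k + 1) / ((INR n + 1) * (alpha + INR n + 1))) in *.
    assert (0 < t) by (apply Rdiv_lt_0_compat; nra).
    cbn [pow]. rewrite (Rmult_comm t), <- Rmult_assoc.
    apply Rmult_le_compat.
    + apply Rmult_le_pos; [|apply pow_le; lra].
      apply Rlt_le, gbinom_pos. lra.
    + lra.
    + apply IH; lia.
    + unfold t.
      replace ((INR k + 1) / ((INR n + 1) * (alpha + INR n + 1)))
        with ((INR k + 1) / (INR n + 1) / (alpha + INR n + 1))
        by (field; lra).
      (* From [i + 1 <= n <= k], the difference [(k - i) * (n + 1) - (k + 1)] is at least
         [n * (k - n) >= 0]. *)
      assert (h1 : (INR k + 1) / (INR n + 1) <= INR k - INR i).
      { apply Rmult_le_reg_r with (INR n + 1); [lra|].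
        unfold Rdiv. rewrite Rmult_assoc, Rinv_l by lra. nra. }
      assert (h2 : 0 < (INR k + 1) / (INR n + 1)) by (apply Rdiv_lt_0_compat; lra).
      apply Rmult_le_compat; [lra | | exact h1 |].
      * apply Rlt_le, Rinv_0_lt_compat. lra.
      * apply Rinv_le_contravar; lra.
Qed.

Lemma laguerre_coef_nonneg (k i : nat) (alpha : R) :
  0 <= alpha -> 0 <= laguerre_coef k alpha i.
Proof.
  intros ha. unfold laguerre_coef. destruct (Nat.leb_spec i k); [|lra].
  apply Rlt_le, Rdiv_lt_0_compat; [|apply INR_fact_lt_0].
  apply gbinom_pos. rewrite minus_INR by easy.
  pose proof (pos_INR i). lra.
Qed.

Lemma half_exp_coef_pos (i : nat) : 0 < half_exp_coef i.
Proof.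
  apply Rdiv_lt_0_compat; [apply pow_lt; lra | apply INR_fact_lt_0].
Qed.

(** With b the diagonal binomial, the bounds b k^i / i! and (1/2)^(n-i) / (n-i)! convolve, by the
    binomial theorem, to b (k + 1/2)^n / n!. *)
Lemma laguerre_exp_coef_le (k n : nat) (alpha : R) :
  0 <= alpha ->
  laguerre_exp_coef k alpha n
  <= gbinom (INR k + alpha) k * (INR k + 1) ^ n / INR (fact n).
Proof.
  intros ha. unfold laguerre_exp_coef, PS_mult.
  set (b := gbinom (INR k + alpha) k).
  assert (hb : 0 < b) by (apply gbinom_pos; lra).
  assert (hk : 0 <= INR k) by apply pos_INR.
  apply Rle_trans with (b * (INR k + 1 / 2) ^ n / INR (fact n)).
  - rewrite binomial.
    replace (b * sum_f_R0 (fun i => Binomial.C n i * INR k ^ i * (1 / 2) ^ (n - i)) n / INR (fact n))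
      with (b / INR (fact n) * sum_f_R0 (fun i => Binomial.C n i * INR k ^ i * (1 / 2) ^ (n - i)) n)
      by (field; apply INR_fact_neq_0).
    rewrite scal_sum. apply sum_Rle. intros i hi.
    unfold half_exp_coef, Binomial.C.
    replace (INR (fact n) / (INR (fact i) * INR (fact (n - i))) * INR k ^ i * (1 / 2) ^ (n - i) * (b / INR (fact n)))
      with (b * INR k ^ i / INR (fact i) * ((1 / 2) ^ (n - i) / INR (fact (n - i))))
      by (field; repeat split; apply INR_fact_neq_0).
    apply Rmult_le_compat_r; [apply Rlt_le, (half_exp_coef_pos (n - i))|].
    unfold laguerre_coef. destruct (Nat.leb_spec i k).
    + apply Rmult_le_compat_r; [apply Rlt_le, Rinv_0_lt_compat, INR_fact_lt_0|].
      now apply gbinom_below_diag_le.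
    + apply Rmult_le_pos; [|apply Rlt_le, Rinv_0_lt_compat, INR_fact_lt_0].
      apply Rmult_le_pos; [lra | now apply pow_le].
  - apply Rmult_le_compat_r; [apply Rlt_le, Rinv_0_lt_compat, INR_fact_lt_0|].
    apply Rmult_le_compat_l; [lra|]. apply pow_incr. lra.
Qed.

Lemma term_le_sum_f_R0 (f : nat -> R) (n i : nat) :
  (forall p, 0 <= f p) -> (i <= n)%nat -> f i <= sum_f_R0 f n.
Proof.
  intros hf hi. induction hi as [|n hi IH].
  - destruct i as [|i]; simpl; [lra|]. pose proof (cond_pos_sum f i hf). lra.
  - simpl. pose proof (hf (S n)). lra.
Qed.

Lemma laguerre_exp_coef_nonneg (k n : nat) (alpha : R) :
  0 <= alpha -> 0 <= laguerre_exp_coef k alpha n.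
Proof.
  intros ha. apply cond_pos_sum. intros i.
  apply Rmult_le_pos; [now apply laguerre_coef_nonneg|].
  apply Rlt_le, half_exp_coef_pos.
Qed.

(* For k >= n the top Laguerre coefficient in the Cauchy product is already of the right
   order; for the finitely many k < n the exponential alone suffices. *)
Lemma laguerre_exp_coef_ge (n : nat) (alpha : R) :
  0 <= alpha ->
  exists kappa : R, 0 < kappa /\ forall k : nat,
    kappa * (gbinom (INR k + alpha) k * (INR k + 1) ^ n)
    <= laguerre_exp_coef k alpha n.
Proof.
  intros ha. assert (hn : 0 <= INR n) by apply pos_INR.
  (* One denominator for both regimes: [(k + 1) / d] is below the ratio bound when [n <= k], and at
     most 1/2 when [k < n]. *)
  set (d := 2 * (INR n + 1) * (alpha + INR n + 1)).
  assert (hd : 0 < d) by (unfold d; nra).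
  assert (hf : 0 < / INR (fact n)) by (apply Rinv_0_lt_compat, INR_fact_lt_0).
  exists ((/ d) ^ n * / INR (fact n)). split.
  { apply Rmult_lt_0_compat; [|easy]. apply pow_lt, Rinv_0_lt_compat, hd. }
  intros k. assert (hk : 0 <= INR k) by apply pos_INR.
  assert (hb : 0 < gbinom (INR k + alpha) k) by (apply gbinom_pos; lra).
  set (b := gbinom (INR k + alpha) k) in *.
  set (f := fun i => laguerre_coef k alpha i * half_exp_coef (n - i)).
  assert (hfpos : forall p, 0 <= f p).
  { intros p. apply Rmult_le_pos; [now apply laguerre_coef_nonneg|].
    apply Rlt_le, half_exp_coef_pos. }
  change (laguerre_exp_coef k alpha n) with (sum_f_R0 f n).
  replace ((/ d) ^ n * / INR (fact n) * (b * (INR k + 1) ^ n))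
    with (b * (/ d * (INR k + 1)) ^ n * / INR (fact n))
    by (rewrite Rpow_mult_distr; ring).
  destruct (Nat.le_gt_cases n k) as [hnk|hnk].
  - apply Rle_trans with (f n); [|now apply term_le_sum_f_R0].
    unfold f, half_exp_coef, laguerre_coef.
    rewrite Nat.sub_diag. destruct (Nat.leb_spec n k); [|lia].
    cbn [pow fact]. rewrite INR_1.
    replace (1 / 1) with 1 by field. rewrite Rmult_1_r.
    apply Rmult_le_compat_r; [lra|].
    apply Rle_trans with (2 := gbinom_below_diag_ge k n n alpha ha (le_n n) hnk).
    apply Rmult_le_compat_l; [fold b; lra|].
    apply pow_incr. unfold d. split.
    + apply Rmult_le_pos; [|lra]. apply Rlt_le, Rinv_0_lt_compat, hd.
    + unfold Rdiv. rewrite (Rmult_comm (INR k + 1)).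
      apply Rmult_le_compat_r; [lra|]. apply Rinv_le_contravar; nra.
  - apply Rle_trans with (f O); [|apply term_le_sum_f_R0; [easy | lia]].
    unfold f, half_exp_coef, laguerre_coef.
    rewrite !Nat.sub_0_r. destruct (Nat.leb_spec 0 k); [|lia].
    fold b. cbn [fact]. rewrite INR_1.
    unfold Rdiv. rewrite Rinv_1, !Rmult_1_r, <- Rmult_assoc.
    apply Rmult_le_compat_r; [lra|]. apply Rmult_le_compat_l; [lra|].
    apply pow_incr. split.
    + apply Rmult_le_pos; [|lra]. apply Rlt_le, Rinv_0_lt_compat, hd.
    + apply Rmult_le_reg_l with d; [easy|].
      rewrite <- Rmult_assoc, Rinv_r by lra.
      assert (INR k < INR n) by (now apply lt_INR). unfold d. nra.
Qed.

(** * The size of the normalised value at the origin *)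

Lemma gbinom_succ_succ (a : R) (n : nat) :
  gbinom (a + 1) (S n) = gbinom a n * (a + 1) / INR (S n).
Proof.
  induction n as [|n IH]; [cbn [gbinom]; rewrite INR_0; f_equal; ring|].
  change (gbinom (a + 1) (S (S n)))
    with (gbinom (a + 1) (S n) * (a + 1 - INR (S n)) / INR (S (S n))).
  rewrite IH. cbn [gbinom]. rewrite !S_INR.
  assert (0 <= INR n) by apply pos_INR. field. lra.
Qed.

Lemma gbinom_diag_succ (k : nat) (alpha : R) :
  gbinom (INR (S k) + alpha) (S k)
  = gbinom (INR k + alpha) k * (1 + alpha / (INR k + 1)).
Proof.
  assert (0 <= INR k) by apply pos_INR.
  replace (INR (S k) + alpha) with (INR k + alpha + 1) by (rewrite S_INR; ring).
  rewrite gbinom_succ_succ, S_INR. field. lra.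
Qed.

(** Passing from [k] to [k + 1] multiplies both sides by [k + alpha + 1]. [Gamma 1] stays as a
    symbol and becomes part of the constant. *)
Lemma Gamma_ratio (k : nat) (alpha : R) :
  0 <= alpha ->
  Gamma (INR k + alpha + 1) * Gamma 1
  = Gamma (alpha + 1) * gbinom (INR k + alpha) k * Gamma (INR k + 1).
Proof.
  intros ha. induction k as [|k IH].
  - cbn [gbinom]. rewrite INR_0, !Rplus_0_l. ring.
  - assert (0 <= INR k) by apply pos_INR.
    rewrite gbinom_diag_succ, S_INR.
    replace (INR k + 1 + alpha + 1) with (INR k + alpha + 1 + 1) by ring.
    rewrite !(Gamma_succ (_ + 1)) by lra.
    transitivity ((INR k + alpha + 1) * (Gamma (INR k + alpha + 1) * Gamma 1));
      [ring|].
    rewrite IH. field. lra.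
Qed.

Lemma exp_le (x y : R) : x <= y -> exp x <= exp y.
Proof. intros [h | ->]; [now apply Rlt_le, exp_increasing | lra]. Qed.

Lemma ln_ge_1_sub_inv (y : R) : 0 < y -> 1 - / y <= ln y.
Proof.
  intros hy. pose proof (ln_le_sub1 (/ y) (Rinv_0_lt_compat _ hy)) as h.
  rewrite ln_Rinv in h by easy. lra.
Qed.

(* The diagonal binomial is the product of the 1 + alpha / i over 1 <= i <= k; comparing
   logarithms, the corrections to alpha ln (k + 1) telescope. *)
Lemma gbinom_diag_bounds (k : nat) (alpha : R) :
  0 <= alpha ->
  exp (alpha * ln (INR k + 1) - 2 * alpha ^ 2 * (1 - / (INR k + 1)))
  <= gbinom (INR k + alpha) k
  <= exp (alpha * ln (INR k + 1) + alpha * (1 - / (INR k + 1))).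
Proof.
  intros ha. induction k as [|k IH].
  - cbn [gbinom]. rewrite INR_0, Rplus_0_l, ln_1, Rinv_1.
    split; rewrite <- exp_0; apply exp_le; lra.
  - rewrite gbinom_diag_succ, S_INR.
    assert (hk : 0 <= INR k) by apply pos_INR.
    set (i := INR k + 1) in *. assert (hi : 1 <= i) by (unfold i; lra).
    assert (hg : 0 < gbinom (INR k + alpha) k) by (apply gbinom_pos; lra).
    assert (h0 : 0 <= alpha / i) by (apply Rdiv_le_0_compat; lra).
    assert (hy : 0 < (i + 1) / i) by (apply Rdiv_lt_0_compat; lra).
    assert (hln : ln (i + 1) = ln i + ln ((i + 1) / i)).
    { rewrite <- ln_mult by lra. f_equal. field. lra. }
    assert (hinv : / i - / (i + 1) = / (i * (i + 1))) by (field; lra).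
    split.
    + assert (h1 : exp (1 - / (1 + alpha / i)) <= 1 + alpha / i).
      { rewrite <- (exp_ln (1 + alpha / i)) at 2 by lra.
        apply exp_le, ln_ge_1_sub_inv. lra. }
      apply Rle_trans with
        (exp (alpha * ln i - 2 * alpha ^ 2 * (1 - / i)) * exp (1 - / (1 + alpha / i))).
      2:{ apply Rmult_le_compat; try (apply Rlt_le, exp_pos); easy. }
      rewrite <- exp_plus. apply exp_le. rewrite hln.
      assert (h2 := ln_le_sub1 _ hy).
      replace ((i + 1) / i - 1) with (/ i) in h2 by (field; lra).
      apply (Rmult_le_compat_l alpha) in h2; [|easy].
      (* The loss in the lower bound is [alpha^2 / (i (i + alpha))], at most
         [2 alpha^2 / (i (i + 1))], which is [2 alpha^2] times the telescoping difference
         [1/i - 1/(i + 1)]. *)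
      assert (h3 : alpha * / i - (1 - / (1 + alpha / i)) <= 2 * alpha ^ 2 * / (i * (i + 1))).
      { replace (alpha * / i - (1 - / (1 + alpha / i)))
          with (alpha ^ 2 * / (i * (i + alpha))) by (field; lra).
        assert (h4 : / (i * (i + alpha)) <= / (i * i))
          by (apply Rinv_le_contravar; nra).
        assert (h5 : / (i * i) <= 2 * / (i * (i + 1))).
        { replace (2 * / (i * (i + 1))) with (/ (i * (i + 1) / 2)) by (field; lra).
          apply Rinv_le_contravar; nra. }
        assert (0 <= alpha ^ 2) by (apply pow_le; easy). nra. }
      rewrite <- hinv in h3. lra.
    + apply Rle_trans with
        (exp (alpha * ln i + alpha * (1 - / i)) * exp (alpha / i)).
      { apply Rmult_le_compat; [lra | lra | easy | apply exp_ineq1_le]. }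
      rewrite <- exp_plus. apply exp_le. rewrite hln.
      (* The logarithm grows by at least [1/(i + 1)], so the excess of [alpha / i] is at most
         [alpha] times the same telescoping difference. *)
      assert (h2 := ln_ge_1_sub_inv _ hy).
      replace (1 - / ((i + 1) / i)) with (/ (i + 1)) in h2 by (field; lra).
      apply (Rmult_le_compat_l alpha) in h2; [|easy].
      unfold Rdiv. lra.
Qed.

(** The normalisation is a constant over the square root of the diagonal binomial g, so its product
    with g is that constant times the square root of g, and g has order (k + 1)^alpha. *)
Lemma laguerre_fun_norm_bounds (alpha : R) :
  0 <= alpha ->
  exists m M : R, 0 < m /\ 0 < M /\ forall k : nat,
    m * Rpower (INR k + 1) (alpha / 2)
    <= sqrt (Gamma (INR k + 1) / Gamma (INR k + alpha + 1))
       * gbinom (INR k + alpha) k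
    <= M * Rpower (INR k + 1) (alpha / 2).
Proof.
  intros ha.
  destruct (Gamma_correct 1) as [h1 _]; [lra|].
  destruct (Gamma_correct (alpha + 1)) as [ha1 _]; [lra|].
  set (s := sqrt (Gamma 1 / Gamma (alpha + 1))).
  assert (hs : 0 < s) by (apply sqrt_lt_R0, Rdiv_lt_0_compat; easy).
  (* The square root halves the correction exponents [- 2 * alpha ^ 2] and [alpha], with
     [1 - / (k + 1)] bounded by 1. *)
  exists (s * exp (- alpha ^ 2)), (s * exp (alpha / 2)).
  split; [apply Rmult_lt_0_compat; [easy | apply exp_pos]|].
  split; [apply Rmult_lt_0_compat; [easy | apply exp_pos]|].
  intros k. assert (hk : 0 <= INR k) by apply pos_INR.
  assert (hg : 0 < gbinom (INR k + alpha) k) by (apply gbinom_pos; lra).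
  destruct (gbinom_diag_bounds k alpha ha) as [hlo hhi].
  assert (hr := Gamma_ratio k alpha ha).
  set (g := gbinom (INR k + alpha) k) in *.
  destruct (Gamma_correct (INR k + 1)) as [hG1 _]; [lra|].
  destruct (Gamma_correct (INR k + alpha + 1)) as [hG2 _]; [lra|].
  assert (hN : sqrt (Gamma (INR k + 1) / Gamma (INR k + alpha + 1)) * g
               = s * sqrt g).
  { replace (Gamma (INR k + 1) / Gamma (INR k + alpha + 1))
      with (Gamma 1 / Gamma (alpha + 1) * / g).
    - rewrite sqrt_mult_alt by (apply Rlt_le, Rdiv_lt_0_compat; easy).
      fold s. rewrite sqrt_inv.
      transitivity (s * / sqrt g * (sqrt g * sqrt g));
        [now rewrite (sqrt_def g) by lra|].
      field. apply Rgt_not_eq, sqrt_lt_R0, hg.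
    - apply Rmult_eq_reg_r
        with (Gamma (INR k + alpha + 1) * (Gamma (alpha + 1) * g));
        [|apply Rgt_not_eq; repeat apply Rmult_lt_0_compat; easy].
      field_simplify; [|lra|lra]. rewrite Rmult_comm, hr. ring. }
  rewrite hN, !Rmult_assoc.
  assert (hsqrt : forall y, sqrt (exp y) = exp (y / 2)).
  { intros y. apply sqrt_lem_1; [apply Rlt_le, exp_pos | apply Rlt_le, exp_pos |].
    rewrite <- exp_plus. f_equal. field. }
  assert (hinv : 0 < / (INR k + 1)) by (apply Rinv_0_lt_compat; lra).
  unfold Rpower. rewrite <- !exp_plus.
  split; (apply Rmult_le_compat_l; [lra|]).
  - apply Rle_trans with (2 := sqrt_le_1_alt _ _ hlo). rewrite hsqrt.
    apply exp_le. assert (0 <= alpha ^ 2) by (apply pow_le; easy). nra.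
  - apply Rle_trans with (1 := sqrt_le_1_alt _ _ hhi). rewrite hsqrt.
    apply exp_le. nra.
Qed.

(** * Termwise differentiation and the final estimates *)

(** The quotient is [j!] times a binomial coefficient, which is at most the sum of its row. Growth
    geometric in [p] is what lets the factors created by differentiation enter the ratio of a
    geometric majorant. *)
Lemma fact_quotient_le (p j : nat) :
  INR (fact (p + j)) / INR (fact p) <= INR (fact j) * 2 ^ (p + j).
Proof.
  assert (hC : Binomial.C (p + j) p <= 2 ^ (p + j)).
  { replace 2 with (1 + 1) by ring. rewrite binomial.
    set (f := fun i => Binomial.C (p + j) i * 1 ^ i * 1 ^ (p + j - i)).
    replace (Binomial.C (p + j) p) with (f p)
      by (unfold f; rewrite !pow1; ring).
    apply term_le_sum_f_R0; [|lia]. intros i. unfold f, Binomial.C.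
    rewrite !pow1, !Rmult_1_r. apply Rlt_le, Rdiv_lt_0_compat;
      [|apply Rmult_lt_0_compat]; apply INR_fact_lt_0. }
  replace (INR (fact (p + j)) / INR (fact p))
    with (INR (fact j) * Binomial.C (p + j) p).
  - apply Rmult_le_compat_l; [apply Rlt_le, INR_fact_lt_0 | exact hC].
  - unfold Binomial.C. replace (p + j - p)%nat with j by lia.
    field. split; apply INR_fact_neq_0.
Qed.

Lemma fact_quotient_ge_1 (p j : nat) : 1 <= INR (fact (p + j)) / INR (fact p).
Proof.
  apply Rmult_le_reg_r with (INR (fact p)); [apply INR_fact_lt_0|].
  unfold Rdiv. rewrite Rmult_assoc, Rinv_l, Rmult_1_l, Rmult_1_r
    by apply INR_fact_neq_0.
  apply le_INR, fact_le. lia.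
Qed.

Lemma Rinv_fact_le_1 (n : nat) : / INR (fact n) <= 1.
Proof.
  rewrite <- Rinv_1. apply Rinv_le_contravar; [lra|].
  apply (le_INR 1). apply lt_O_fact.
Qed.

(* With truncated subtraction, [l - j] and [j - l] are the orders of the zero in u and of the
   lowest surviving Taylor coefficient, so that this covers both cases of the theorem. *)
Lemma Derive_n_laguerre (alpha : R) (j l : nat) :
  exists e : nat -> nat -> R,
    (forall k r, e k r = INR (fact (l - j + r + j)) / INR (fact (l - j + r))
       * ((- 1) ^ (j - l + r) * laguerre_exp_coef k alpha (j - l + r))) /\
    (forall k, CV_radius (e k) = p_infty) /\
    forall k u, 0 < u ->
      Derive_n (fun v => laguerre_fun k alpha v / Rpower v (alpha / 2 - INR l)) j u
      = sqrt (Gamma (INR k + 1) / Gamma (INR k + alpha + 1))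
        * (u ^ (l - j) * PSeries (e k) u).
Proof.
  set (a := fun k n => (- 1) ^ n * laguerre_exp_coef k alpha n).
  set (d := fun k => PS_derive_n j (PS_incr_n (a k) l)).
  assert (ha : forall k x, is_pseries (a k) x
                 (laguerre_poly k alpha x * exp (- x / 2)))
    by (intros; apply is_pseries_laguerre_exp_coef).
  assert (hincr : forall k, CV_radius (PS_incr_n (a k) l) = p_infty).
  { intros k. apply CV_radius_entire. intros x.
    apply (ex_pseries_incr_n (V := R_NormedModule)). eexists. apply ha. }
  assert (hd : forall k, CV_radius (d k) = p_infty).
  { intros k. unfold d. now rewrite CV_radius_derive_n. }
  (* Multiplying by u^l and differentiating [j] times leaves [l - j] vanishing coefficients in
     front, so the factor u^(l-j) can be split off. *)
  exists (fun k => PS_decr_n (d k) (l - j)). split; [|split].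
  - intros k r. unfold PS_decr_n, d, PS_derive_n. f_equal.
    rewrite PS_incr_n_simplify.
    destruct (Compare_dec.le_lt_dec l (l - j + r + j)); [|lia].
    unfold a. replace (l - j + r + j - l)%nat with (j - l + r)%nat by lia. easy.
  - intros k. apply CV_radius_entire. intros x.
    apply (ex_pseries_decr_n (V := R_NormedModule)).
    + destruct (Req_dec x 0) as [h|h]; [now left | right].
      exists (/ x). now apply Rinv_l.
    + apply CV_radius_inside. now rewrite hd.
  - intros k u hu.
    set (N := sqrt (Gamma (INR k + 1) / Gamma (INR k + alpha + 1))).
    (* For [v > 0] the quotient of real powers is [v ^ l]. The identity with an entire series
       therefore holds near [u], which is enough for derivatives there. *)
    rewrite (Derive_n_ext_loc _ (fun v => N * PSeries (PS_incr_n (a k) l) v)).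
    + rewrite Derive_n_scal_l, Derive_n_PSeries by (now rewrite hincr).
      f_equal. apply PSeries_decr_n_aux. intros p hp.
      unfold d, PS_derive_n. rewrite PS_incr_n_simplify.
      destruct (Compare_dec.le_lt_dec l (p + j)); [lia|].
      change (@zero _) with 0. ring.
    + apply (locally_interval _ u 0 p_infty); simpl; try easy.
      intros v hv _. rewrite PSeries_incr_n, (is_pseries_unique _ _ _ (ha k v)).
      unfold laguerre_fun. fold N.
      replace (Rpower v (alpha / 2)) with (Rpower v (alpha / 2 - INR l) * v ^ l).
      * field. apply Rgt_not_eq, exp_pos.
      * rewrite <- Rpower_pow, <- Rpower_plus by easy. f_equal. ring.
Qed.

(** The leading term of the derived series, with its sign removed, lies between [kappa * W] and
    [K * W], and the remainder is at most half of the lower bound. The sum thus keeps the sign and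
    order of its first term. *)
Lemma laguerre_derivative_bounds (alpha : R) (j l : nat) :
  0 <= alpha ->
  exists c m M : R, 0 < c /\ 0 < m /\ 0 < M /\
    forall (k : nat) (u : R), 0 < u < c / (INR k + 1) ->
      let B := Rpower (INR k + 1) (alpha / 2) * (INR k + 1) ^ (j - l)
               * u ^ (l - j) in
      m * B
      <= (- 1) ^ (j - l)
         * Derive_n (fun v => laguerre_fun k alpha v
                              / Rpower v (alpha / 2 - INR l)) j u
      <= M * B.
Proof.
  intros ha.
  destruct (laguerre_fun_norm_bounds alpha ha) as (m & M & hm & hM & hN).
  destruct (Derive_n_laguerre alpha j l) as (e & he & hcv & hder).
  set (n := (j - l)%nat) in *. set (q := (l - j)%nat) in *.
  destruct (laguerre_exp_coef_ge n alpha ha) as (kappa & hkappa & hlow).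
  set (K := INR (fact j) * 2 ^ (q + j)).
  assert (hK : 0 < K).
  { apply Rmult_lt_0_compat; [apply INR_fact_lt_0 | apply pow_lt; lra]. }
  (* The bound 1/4 keeps the geometric ratio [2 * (k + 1) * u] below 1/2; the other bound keeps the
     remainder, at most [4 * K * c * W], below [kappa / 2 * W]. *)
  set (c := Rmin (1 / 4) (kappa / (8 * K))).
  assert (hc : 0 < c).
  { apply Rmin_pos; [lra|]. apply Rdiv_lt_0_compat; lra. }
  assert (hc1 : c <= 1 / 4) by apply Rmin_l.
  assert (hc2 : 4 * K * c <= kappa / 2).
  { apply Rle_trans with (4 * K * (kappa / (8 * K))).
    - apply Rmult_le_compat_l; [lra | apply Rmin_r].
    - right. field. lra. }
  exists c, (m * (kappa / 2)), (M * (2 * K)).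
  split; [easy|]. split; [apply Rmult_lt_0_compat; lra|].
  split; [apply Rmult_lt_0_compat; lra|].
  intros k u [hu0 hu]. cbv zeta.
  assert (hk : 0 <= INR k) by apply pos_INR.
  assert (hb : 0 < gbinom (INR k + alpha) k) by (apply gbinom_pos; lra).
  specialize (hN k). specialize (hlow k). rewrite hder by easy.
  set (Nk := sqrt (Gamma (INR k + 1) / Gamma (INR k + alpha + 1))) in *.
  set (b := gbinom (INR k + alpha) k) in *.
  set (W := b * (INR k + 1) ^ n) in *.
  assert (hpow : 0 < (INR k + 1) ^ n) by (apply pow_lt; lra).
  assert (hW : 0 < W) by (apply Rmult_lt_0_compat; easy).
  assert (hx : (INR k + 1) * u <= c).
  { apply Rmult_lt_compat_r with (r := INR k + 1) in hu; [|lra].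
    replace (c / (INR k + 1) * (INR k + 1)) with c in hu by (field; lra). lra. }
  assert (hquot : forall r,
    INR (fact (q + r + j)) / INR (fact (q + r)) <= K * 2 ^ r).
  { intros r. apply Rle_trans with (1 := fact_quotient_le (q + r) j).
    right. unfold K. replace (q + r + j)%nat with (q + j + r)%nat by lia.
    rewrite pow_add. ring. }
  assert (hcoef : forall r,
    laguerre_exp_coef k alpha (n + r) <= W * (INR k + 1) ^ r).
  { intros r. apply Rle_trans with (1 := laguerre_exp_coef_le k (n + r) alpha ha).
    fold b. unfold W. rewrite pow_add, <- Rmult_assoc.
    assert (h := Rinv_fact_le_1 (n + r)).
    assert (0 < b * (INR k + 1) ^ n * (INR k + 1) ^ r)
      by (apply Rmult_lt_0_compat; [easy | apply pow_lt; lra]).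
    unfold Rdiv. nra. }
  (* In the ratio, 2 comes from the factorial quotient and [k + 1] from the Taylor coefficients. *)
  assert (habs : forall r, Rabs (e k r) <= K * W * (2 * (INR k + 1)) ^ r).
  { intros r. rewrite he, !Rabs_mult, pow_1_abs, Rmult_1_l.
    assert (h1 := fact_quotient_ge_1 (q + r) j).
    rewrite Rabs_pos_eq by lra.
    rewrite Rabs_pos_eq by (now apply laguerre_exp_coef_nonneg).
    replace (K * W * (2 * (INR k + 1)) ^ r)
      with (K * 2 ^ r * (W * (INR k + 1) ^ r)) by (rewrite Rpow_mult_distr; ring).
    apply Rmult_le_compat;
      [lra | now apply laguerre_exp_coef_nonneg | apply hquot | apply hcoef]. }
  assert (htail : Rabs (PSeries (e k) u - e k O)
                  <= 2 * (K * W) * (2 * (INR k + 1)) * u).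
  { apply PSeries_minus_head; try easy; try lra; nra. }
  assert (hsign : Rabs ((- 1) ^ n * PSeries (e k) u - (- 1) ^ n * e k O)
                  <= 4 * K * c * W).
  { rewrite <- Rmult_minus_distr_l, Rabs_mult, pow_1_abs, Rmult_1_l.
    apply Rle_trans with (1 := htail).
    replace (2 * (K * W) * (2 * (INR k + 1)) * u)
      with (4 * K * W * ((INR k + 1) * u)) by ring.
    replace (4 * K * c * W) with (4 * K * W * c) by ring.
    apply Rmult_le_compat_l; [|easy]. apply Rmult_le_pos; lra. }
  assert (hhead : kappa * W <= (- 1) ^ n * e k O <= K * W).
  { rewrite he, (Nat.add_0_r n).
    assert (hsq : (- 1) ^ n * (- 1) ^ n = 1).
    { rewrite <- Rpow_mult_distr. replace (- 1 * - 1) with 1 by ring. apply pow1. }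
    set (Q := INR (fact (q + 0 + j)) / INR (fact (q + 0))).
    replace ((- 1) ^ n * (Q * ((- 1) ^ n * laguerre_exp_coef k alpha n)))
      with ((- 1) ^ n * (- 1) ^ n * (Q * laguerre_exp_coef k alpha n)) by ring.
    rewrite hsq, Rmult_1_l.
    assert (h1 : 1 <= Q) by apply fact_quotient_ge_1.
    assert (h2 : Q <= K * 1) by apply (hquot O).
    assert (h3 := laguerre_exp_coef_nonneg k n alpha ha).
    assert (h4 := hcoef O). rewrite Nat.add_0_r, pow_O, Rmult_1_r in h4.
    split.
    - apply Rle_trans with (1 := hlow). nra.
    - apply Rmult_le_compat; lra. }
  assert (hS : kappa / 2 * W <= (- 1) ^ n * PSeries (e k) u <= 2 * K * W).
  { apply Rabs_le_between in hsign.
    assert (4 * K * c * W <= kappa / 2 * W)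
      by (apply Rmult_le_compat_r; lra).
    assert (4 * K * c * W <= K * W) by (apply Rmult_le_compat_r; nra).
    lra. }
  set (P := Rpower (INR k + 1) (alpha / 2)) in *.
  assert (hP : 0 < P) by apply exp_pos.
  assert (hU : 0 < u ^ q) by (now apply pow_lt).
  assert (hNk : 0 <= Nk) by apply sqrt_pos.
  replace ((- 1) ^ n * (Nk * (u ^ q * PSeries (e k) u)))
    with (Nk * u ^ q * ((- 1) ^ n * PSeries (e k) u)) by ring.
  assert (hNU : 0 <= Nk * u ^ q) by (apply Rmult_le_pos; lra).
  assert (hY : 0 < (INR k + 1) ^ n * u ^ q) by (now apply Rmult_lt_0_compat).
  split.
  - apply Rle_trans with (Nk * u ^ q * (kappa / 2 * W)).
    2:{ apply Rmult_le_compat_l; [easy | apply hS]. }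
    (* The factor [b] of [W] is paired with [Nk], since [hN] controls their product. *)
    replace (Nk * u ^ q * (kappa / 2 * W))
      with (kappa / 2 * ((INR k + 1) ^ n * u ^ q) * (Nk * b)) by (unfold W; ring).
    replace (m * (kappa / 2) * (P * (INR k + 1) ^ n * u ^ q))
      with (kappa / 2 * ((INR k + 1) ^ n * u ^ q) * (m * P)) by ring.
    apply Rmult_le_compat_l; [apply Rmult_le_pos; lra | apply hN].
  - apply Rle_trans with (Nk * u ^ q * (2 * K * W)).
    { apply Rmult_le_compat_l; [easy | apply hS]. }
    replace (Nk * u ^ q * (2 * K * W))
      with (2 * K * ((INR k + 1) ^ n * u ^ q) * (Nk * b)) by (unfold W; ring).
    replace (M * (2 * K) * (P * (INR k + 1) ^ n * u ^ q))
      with (2 * K * ((INR k + 1) ^ n * u ^ q) * (M * P)) by ring.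
    apply Rmult_le_compat_l; [apply Rmult_le_pos; lra | apply hN].
Qed.

Theorem lemma3p4 (alpha : R) (j l : nat) (halpha : 0 <= alpha) :
  exists c : R, 0 < c /\
    ((j <= l)%nat ->
      simeq (fun (k : nat) (u : R) => 0 < u < c / (INR k + 1))
        (fun (k : nat) (u : R) =>
          Derive_n (fun v => laguerre_fun k alpha v
                             / Rpower v (alpha / 2 - INR l)) j u)
        (fun (k : nat) (u : R) =>
          Rpower (INR k + 1) (alpha / 2) * u ^ (l - j))) /\
    ((l <= j)%nat ->
      simeq_sign (fun (k : nat) (u : R) => 0 < u < c / (INR k + 1)) (j - l)
        (fun (k : nat) (u : R) =>
          Derive_n (fun v => laguerre_fun k alpha v
                             / Rpower v (alpha / 2 - INR l)) j u)
        (fun (k : nat) (u : R) =>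
          Rpower (INR k + 1) (alpha / 2 + INR j - INR l))).
Proof.
  destruct (laguerre_derivative_bounds alpha j l halpha)
    as (c & m & M & hc & hm & hM & h).
  exists c. split; [easy|].
  (* [simeq] requires ordered constants, so the upper one is enlarged. *)
  assert (hmM : 0 < m <= Rmax m M) by (split; [easy | apply Rmax_l]).
  split; intros hjl.
  - exists m, (Rmax m M). split; [easy|]. intros k u hu.
    assert (hB : 0 < Rpower (INR k + 1) (alpha / 2) * u ^ (l - j))
      by (apply Rmult_lt_0_compat; [apply exp_pos | now apply pow_lt]).
    specialize (h k u hu). cbv zeta in h.
    replace (j - l)%nat with O in h by lia. simpl pow in h.
    rewrite Rmult_1_l, Rmult_1_r in h.
    split; [apply h|]. apply Rle_trans with (1 := proj2 h).
    apply Rmult_le_compat_r; [lra | apply Rmax_r].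
  - assert (hB : forall k u, 0 < u < c / (INR k + 1) ->
      let B := Rpower (INR k + 1) (alpha / 2 + INR j - INR l) in
      0 < B /\
      m * B <= (- 1) ^ (j - l)
        * Derive_n (fun v => laguerre_fun k alpha v
                             / Rpower v (alpha / 2 - INR l)) j u
      <= Rmax m M * B).
    { intros k u hu B. assert (hB : 0 < B) by apply exp_pos.
      specialize (h k u hu). cbv zeta in h.
      assert (hk : 0 <= INR k) by apply pos_INR.
      assert (hBeq : Rpower (INR k + 1) (alpha / 2) * (INR k + 1) ^ (j - l)
                     * u ^ (l - j) = B).
      { replace (l - j)%nat with O by lia. unfold B.
        rewrite <- Rpower_pow, <- Rpower_plus, minus_INR by (easy || lra).
        simpl pow. rewrite Rmult_1_r. f_equal. ring. }
      rewrite hBeq in h. split; [easy|]. split; [apply h|].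
      apply Rle_trans with (1 := proj2 h).
      apply Rmult_le_compat_r; [lra | apply Rmax_r]. }
    clear h. cbv zeta in hB. unfold simeq_sign.
    destruct (Nat.even (j - l)) eqn:heven.
    + apply Nat.even_spec in heven as [p hp].
      exists m, (Rmax m M). split; [easy|]. intros k u hu.
      destruct (hB k u hu) as [_ h].
      now rewrite hp, pow_1_even, Rmult_1_l in h.
    + assert (hodd : Nat.odd (j - l) = true)
        by (now rewrite <- Nat.negb_even, heven).
      apply Nat.odd_spec in hodd as [p hp].
      rewrite hp, Nat.add_1_r, pow_1_odd in hB.
      split.
      (* Strict negativity follows because minus the derivative is at least [m * B > 0]. *)
      * intros k u hu. destruct (hB k u hu) as [h0 h]. nra.
      * exists m, (Rmax m M). split; [easy|]. intros k u hu.
        destruct (hB k u hu) as [_ h]. lra.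
Qed.
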